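(* Let $a>b>0$ and consider the family of Poncelet triangles of the confocal pair with outer ellipse of semi-axes $a,b$. Let $\delta=\sqrt{a^4-a^2b^2+b^4}$, let $\alpha,\beta\in\mathbb{R}$ with $\beta\neq 0$, and let $\mathcal{X}=\alpha X_2+\beta X_3$. The locus of $\mathcal{X}$ over the family is degenerate when $$\frac{\alpha}{\beta}=\frac{2a^2-b^2+\delta}{2b^2}\quad\text{or}\quad \frac{\alpha}{\beta}=\frac{2b^2-a^2+\delta}{2a^2}.$$
   Context: Confocal pair: the outer ellipse is $\frac{x^2}{a^2}+\frac{y^2}{b^2}=1$ with $a>b>0$; put $c^2=a^2-b^2$ and $\delta=\sqrt{a^4-a^2b^2+b^4}$. The inner ellipse (caustic) is the ellipse confocal with it having semi-axes $a_c=a(\delta-b^2)/c^2$ along the $x$-axis and $b_c=b(a^2-\delta)/c^2$ along the $y$-axis. This is the confocal ellipse for which triangles exist that are inscribed in the outer ellipse and have all side lines tangent to the inner one; these are the Poncelet triangles, and every point of the outer ellipse is a vertex of exactly one of them. $X_2$ is the barycenter (centroid) and $X_3$ the circumcenter of a triangle, regarded as vectors in the plane with origin at the common center of the ellipses. The locus of $\mathcal{X}$ is the set of its positions over all triangles of the family; it is known to be a (possibly degenerate) ellipse, and it is called degenerate if one or both of its semi-axes are zero, i.e. if it is a segment or a single point. *)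

(* Defs.v *)
From mathcomp Require Import all_boot all_order all_algebra.
From mathcomp Require Import classical_sets reals trigo.

Set Implicit Arguments.
Unset Strict Implicit.
Unset Printing Implicit Defensive.

Import GRing.Theory Num.Theory.

Local Open Scope classical_set_scope.
Local Open Scope ring_scope.

Section PonceletTriangles.
Variable R : realType.

(* The library's norm on row vectors is the supremum norm, so Euclidean
   notions are expressed through this dot product. *)
Definition dot (u v : 'rV[R]_2) : R := \sum_(i < 2) u 0 i * v 0 i.

Definition line (A B : 'rV[R]_2) : set 'rV[R]_2 :=
  range (fun t : R => A + t *: (B - A)).

Definition triangle (A B C : 'rV[R]_2) : Prop := A <> B /\ ~ line A B C.

Definition centroid (A B C : 'rV[R]_2) : 'rV[R]_2 := 3%:R^-1 *: (A + B + C).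

(* For a nondegenerate triangle exactly one point O satisfies this. *)
Definition is_circumcenter (A B C O : 'rV[R]_2) : Prop :=
  dot (A - O) (A - O) = dot (B - O) (B - O) /\
  dot (A - O) (A - O) = dot (C - O) (C - O).

Definition std_ellipse (a b : R) : set 'rV[R]_2 :=
  [set P | P 0 0 ^+ 2 / a ^+ 2 + P 0 1 ^+ 2 / b ^+ 2 = 1].

(* Gradient at P of the quadratic form x^2/a^2 + y^2/b^2. *)
Definition std_ellipse_grad (a b : R) (P : 'rV[R]_2) : 'rV[R]_2 :=
  \row_(i < 2) (2%:R * P 0 i / (if i == 0 then a else b) ^+ 2).

(* The line AB passes through a point of the ellipse in the direction of the
   tangent there (for A <> B). *)
Definition side_tangent (a b : R) (A B : 'rV[R]_2) : Prop :=
  exists T : 'rV[R]_2, [/\ std_ellipse a b T, line A B T &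
    dot (std_ellipse_grad a b T) (B - A) = 0].

Definition delta (a b : R) : R :=
  Num.sqrt (a ^+ 4 - a ^+ 2 * b ^+ 2 + b ^+ 4).

Definition caustic_a (a b : R) : R :=
  a * (delta a b - b ^+ 2) / (a ^+ 2 - b ^+ 2).

Definition caustic_b (a b : R) : R :=
  b * (a ^+ 2 - delta a b) / (a ^+ 2 - b ^+ 2).

Definition poncelet_triangle (a b : R) (A B C : 'rV[R]_2) : Prop :=
  let tangent := side_tangent (caustic_a a b) (caustic_b a b) in
  [/\ triangle A B C,
      [/\ std_ellipse a b A, std_ellipse a b B & std_ellipse a b C] &
      [/\ tangent A B, tangent B C & tangent C A]].

Definition locus (a b alpha beta : R) : set 'rV[R]_2 :=
  [set X | exists A B C X3 : 'rV[R]_2,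
    [/\ poncelet_triangle a b A B C, is_circumcenter A B C X3 &
        X = alpha *: centroid A B C + beta *: X3]].

(* E is an ellipse, in arbitrary position, with semi-axes s along u and t
   along v; the values s = 0 and t = 0 are allowed. *)
Definition is_ellipse (E : set 'rV[R]_2) (s t : R) : Prop :=
  exists P u v : 'rV[R]_2,
    [/\ [/\ dot u u = 1, dot v v = 1 & dot u v = 0], 0 <= s, 0 <= t &
        E = range (fun theta : R =>
              P + (s * cos theta) *: u + (t * sin theta) *: v)].

Definition degenerate (E : set 'rV[R]_2) : Prop :=
  exists s t : R, is_ellipse E s t /\ (s = 0 \/ t = 0).

End PonceletTriangles.

(* Main.v *)
(** In the coordinates (x/a, y/b) the outer ellipse is the unit circle and the
caustic has semi-axes p = a_c/a and q = b_c/b, with p + q = 1. Because of this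
relation, the chord joining (x1,y1) and (x2,y2) is tangent to the caustic iff
x1 x2 / p + y1 y2 / q = -1, a bilinear condition. The side opposite to a vertex
A thus lies on the line with normal (A_x/p, A_y/q), which determines the sum of
the other two vertices. It follows that the sum S of the three vertices has
norm |q - p|, and that the coordinates of the circumcenter are constant
multiples of S_x and S_y. So X = (m_x S_x, m_y S_y) with constants m_x, m_y; the
first ratio is m_y = 0 and the second one m_x = 0. The locus is then the whole
segment: by the intermediate value theorem along the unit circle, S_x and S_y
take all values between -|q - p| and |q - p|. *)

Require Import Defs.
From mathcomp Require Import all_boot all_order all_algebra.
From mathcomp Require Import classical_sets reals trigo.
From mathcomp Require Import ring lra.

Set Implicit Arguments.
Unset Strict Implicit.
Unset Printing Implicit Defensive.

Import Order.TTheory GRing.Theory Num.Theory.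

Local Open Scope ring_scope.

(** * Orthogonality in the coordinate plane *)

Lemma sqrD_gt0 (F : realFieldType) (x y : F) :
  (x, y) != (0, 0) -> 0 < x ^+ 2 + y ^+ 2.
Proof.
rewrite xpair_eqE negb_and lt0r addr_ge0 ?sqr_ge0// andbT.
by rewrite paddr_eq0 ?sqr_ge0// !sqrf_eq0 negb_and.
Qed.

(** In the plane, the vectors orthogonal to a nonzero [d] form a single line, so [u] and [v] are
    parallel. *)
Lemma cross_eq0 (F : realFieldType) (dx dy ux uy vx vy : F) :
  (dx, dy) != (0, 0) -> ux * dx + uy * dy = 0 -> vx * dx + vy * dy = 0 ->
  ux * vy - uy * vx = 0.
Proof.
move=> /sqrD_gt0 d_gt0 ud vd.
apply: (mulIf (lt0r_neq0 d_gt0)); rewrite mul0r.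
have -> : (ux * vy - uy * vx) * (dx ^+ 2 + dy ^+ 2) =
  (ux * dx + uy * dy) * (vy * dx - vx * dy)
  - (vx * dx + vy * dy) * (uy * dx - ux * dy) by ring.
by rewrite ud vd !mul0r subrr.
Qed.

Lemma orthogonal_eq0 (F : fieldType) (ux uy vx vy wx wy : F) :
  ux * vy - uy * vx != 0 -> wx * ux + wy * uy = 0 -> wx * vx + wy * vy = 0 ->
  wx = 0 /\ wy = 0.
Proof.
move=> uv_neq0 wu wv; split; apply: (mulIf uv_neq0); rewrite mul0r.
- have -> : wx * (ux * vy - uy * vx) =
    (wx * ux + wy * uy) * vy - (wx * vx + wy * vy) * uy by ring.
  by rewrite wu wv !mul0r subrr.
- have -> : wy * (ux * vy - uy * vx) =
    (wx * vx + wy * vy) * ux - (wx * ux + wy * uy) * vx by ring.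
  by rewrite wu wv !mul0r subrr.
Qed.

(** * Chords of the unit circle tangent to the ellipse of semi-axes [p], [q] *)

Section UnitCircle.
Variables (F : realFieldType) (p q : F).
Hypotheses (p_gt0 : 0 < p) (q_gt0 : 0 < q) (pqE : q = 1 - p).

(* Tangency of a chord of the unit circle to the caustic, with the denominators
   of [x1 x2 / p + y1 y2 / q = -1] cleared. *)
Definition conj_chord (x1 y1 x2 y2 : F) : Prop :=
  q * (x1 * x2) + p * (y1 * y2) + p * q = 0.

(** The squared length of [(q x, p y)], the normal of the side opposite to [(x, y)] with
    denominators cleared. *)
Definition polar_norm (x y : F) : F := q ^+ 2 * x ^+ 2 + p ^+ 2 * y ^+ 2.

Lemma conj_chordC x1 y1 x2 y2 :
  conj_chord x1 y1 x2 y2 -> conj_chord x2 y2 x1 y1.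
Proof. by rewrite /conj_chord (mulrC x1) (mulrC y1). Qed.

Lemma polar_norm_gt0 x y : x ^+ 2 + y ^+ 2 = 1 -> 0 < polar_norm x y.
Proof.
move=> xy1; rewrite /polar_norm -!exprMn; apply: sqrD_gt0.
rewrite xpair_eqE !mulf_eq0 (gt_eqF p_gt0) (gt_eqF q_gt0) /=.
apply/negP => /andP[/eqP x0 /eqP y0]; move/eqP: xy1.
by rewrite x0 y0 expr0n addr0 eq_sym oner_eq0.
Qed.

(* [(q x1, p y1)] and [B + C] are both orthogonal to [B - C]. *)
Lemma conj_chord_sum x1 y1 x2 y2 x3 y3 :
  x2 ^+ 2 + y2 ^+ 2 = 1 -> x3 ^+ 2 + y3 ^+ 2 = 1 -> (x2, y2) != (x3, y3) ->
  conj_chord x1 y1 x2 y2 -> conj_chord x1 y1 x3 y3 ->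
  polar_norm x1 y1 * (x2 + x3) = - (2 * p * q) * (q * x1) /\
  polar_norm x1 y1 * (y2 + y3) = - (2 * p * q) * (p * y1).
Proof.
move=> c2 c3 ne23 m2 m3; rewrite /conj_chord in m2 m3.
have d_neq0 : (x2 - x3, y2 - y3) != (0, 0).
  by move: ne23; rewrite !xpair_eqE !subr_eq0.
have nd : (q * x1) * (x2 - x3) + (p * y1) * (y2 - y3) = 0 by nra.
have sd : (x2 + x3) * (x2 - x3) + (y2 + y3) * (y2 - y3) = 0 by nra.
have ns := cross_eq0 d_neq0 nd sd.
(* The sum of the two chord relations. With n = [(q x1, p y1)] and s = B + C parallel, |n|^2 s =
   (n.s) n, which is the claim. *)
have nsE : (q * x1) * (x2 + x3) + (p * y1) * (y2 + y3) = - (2 * p * q) by nra.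
split; rewrite /polar_norm -nsE.
- have -> : (q ^+ 2 * x1 ^+ 2 + p ^+ 2 * y1 ^+ 2) * (x2 + x3) =
    (q * x1 * (x2 + x3) + p * y1 * (y2 + y3)) * (q * x1)
    - p * y1 * (q * x1 * (y2 + y3) - p * y1 * (x2 + x3)) by ring.
  by rewrite ns mulr0 subr0.
- have -> : (q ^+ 2 * x1 ^+ 2 + p ^+ 2 * y1 ^+ 2) * (y2 + y3) =
    (q * x1 * (x2 + x3) + p * y1 * (y2 + y3)) * (p * y1)
    + q * x1 * (q * x1 * (y2 + y3) - p * y1 * (x2 + x3)) by ring.
  by rewrite ns mulr0 addr0.
Qed.

Definition conj_triangle (x1 y1 x2 y2 x3 y3 : F) : Prop :=
  [/\ [/\ x1 ^+ 2 + y1 ^+ 2 = 1, x2 ^+ 2 + y2 ^+ 2 = 1 & x3 ^+ 2 + y3 ^+ 2 = 1],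
      (x2, y2) != (x3, y3) &
      [/\ conj_chord x1 y1 x2 y2, conj_chord x2 y2 x3 y3 &
          conj_chord x3 y3 x1 y1]].

Section ConjTriangle.
Variables x1 y1 x2 y2 x3 y3 : F.
Hypothesis tri : conj_triangle x1 y1 x2 y2 x3 y3.

Let D_neq0 : polar_norm x1 y1 != 0.
Proof. by case: tri => -[c1 _ _] _ _; apply/lt0r_neq0/polar_norm_gt0. Qed.

Let chordD : q * x1 * (x2 - x3) + p * y1 * (y2 - y3) = 0.
Proof. by case: tri => _ _ []; rewrite /conj_chord => m12 _ m31; nra. Qed.

Let y1E : y1 ^+ 2 = 1 - x1 ^+ 2.
Proof. by case: tri => -[<- _ _] _ _; rewrite addrAC subrr add0r. Qed.

(** If A, B, C were collinear, A - B would be orthogonal to [(q x1, p y1)] as B - C is. The chord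
    relation of A and B would then read [q * x1 ^+ 2 + p * y1 ^+ 2 + p * q = 0], a sum with a
    positive term. *)
Lemma conj_triangle_cross :
  (x2 - x3) * (y1 - y2) - (y2 - y3) * (x1 - x2) != 0.
Proof.
case: tri => -[c1 c2 c3] ne23 [m12 _ _]; rewrite /conj_chord in m12.
have d_neq0 : (x2 - x3, y2 - y3) != (0, 0).
  by move: ne23; rewrite !xpair_eqE !subr_eq0.
apply/eqP => cross0.
have nA : q * x1 * (x1 - x2) - p * y1 * - (y1 - y2) = 0.
  by apply: (cross_eq0 d_neq0 chordD); rewrite -[RHS]oppr0 -cross0; ring.
have : 0 < q * x1 ^+ 2 + p * y1 ^+ 2 + p * q.
  by rewrite ltr_wpDl ?mulr_gt0 // addr_ge0 // mulr_ge0 ?sqr_ge0 // ltW.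
suff -> : q * x1 ^+ 2 + p * y1 ^+ 2 + p * q = 0 by rewrite ltxx.
by nra.
Qed.

Lemma conj_triangle_rot : conj_triangle x2 y2 x3 y3 x1 y1.
Proof.
case: (tri) => -[c1 c2 c3] ne23 [m12 m23 m31]; split=> //.
apply: contraNneq conj_triangle_cross => -[<- <-].
by apply/eqP; ring.
Qed.

Lemma conj_triangle_sum :
  polar_norm x1 y1 * (x1 + x2 + x3) =
    x1 * (polar_norm x1 y1 - 2 * p * q ^+ 2) /\
  polar_norm x1 y1 * (y1 + y2 + y3) =
    y1 * (polar_norm x1 y1 - 2 * q * p ^+ 2).
Proof.
case: tri => -[c1 c2 c3] ne23 [m12 m23 /conj_chordC m13].
have [sx sy] := conj_chord_sum c2 c3 ne23 m12 m13.
by split; rewrite -addrA mulrDr ?sx ?sy; ring.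
Qed.

Lemma conj_triangle_sum_norm :
  (x1 + x2 + x3) ^+ 2 + (y1 + y2 + y3) ^+ 2 = (q - p) ^+ 2.
Proof.
have [sx sy] := conj_triangle_sum.
apply: (mulfI (expf_neq0 2 D_neq0)); rewrite mulrDr -!exprMn sx sy.
rewrite !exprMn /polar_norm y1E pqE; ring.
Qed.

(** Up to constants, this says that the point with coordinates proportional to (q S_x / a, p S_y /
    b) is equidistant from B and C. By [chordD], both sides times [polar_norm x1 y1] are multiples
    of [q * x1 * (x2 - x3)]. *)
Lemma conj_triangle_circumcenter :
  q * (x1 + x2 + x3) * (x2 - x3) + p * (y1 + y2 + y3) * (y2 - y3) =
  (q - p) * (x2 ^+ 2 - x3 ^+ 2).
Proof.
case: tri => -[c1 c2 c3] ne23 [m12 m23 /conj_chordC m13].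
have [sx sy] := conj_triangle_sum.
have [tx _] := conj_chord_sum c2 c3 ne23 m12 m13.
apply: (mulfI D_neq0).
transitivity (q * (polar_norm x1 y1 * (x1 + x2 + x3)) * (x2 - x3)
            + p * (polar_norm x1 y1 * (y1 + y2 + y3)) * (y2 - y3)); first by ring.
transitivity ((q - p) * (x2 - x3) * (polar_norm x1 y1 * (x2 + x3))); last by ring.
rewrite sx sy tx; move/eqP: chordD; rewrite addr_eq0 => /eqP nd.
transitivity ((polar_norm x1 y1 - 2 * p * q ^+ 2) * (q * x1 * (x2 - x3))
  + (polar_norm x1 y1 - 2 * q * p ^+ 2) * (p * y1 * (y2 - y3))); first by ring.
transitivity (- (2 * p * q) * (q - p) * (q * x1 * (x2 - x3))); last by ring.
by rewrite nd; ring.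
Qed.

End ConjTriangle.

(* [T] is the point of contact with the ellipse of semi-axes [p], [q]. *)
Lemma tangent_conj_chord x1 y1 x2 y2 t Tx Ty :
  x1 ^+ 2 + y1 ^+ 2 = 1 -> x2 ^+ 2 + y2 ^+ 2 = 1 -> (x1, y1) != (x2, y2) ->
  Tx = x1 + t * (x2 - x1) -> Ty = y1 + t * (y2 - y1) ->
  Tx ^+ 2 / p ^+ 2 + Ty ^+ 2 / q ^+ 2 = 1 ->
  Tx * (x2 - x1) / p ^+ 2 + Ty * (y2 - y1) / q ^+ 2 = 0 ->
  conj_chord x1 y1 x2 y2.
Proof.
move=> c1 c2 ne12 TxE TyE onT tgT.
have [p_neq0 q_neq0] : p != 0 /\ q != 0 by rewrite !gt_eqF.
have {}onT : q ^+ 2 * Tx ^+ 2 + p ^+ 2 * Ty ^+ 2 = p ^+ 2 * q ^+ 2.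
  by rewrite -[RHS]mulr1 -onT; field; rewrite p_neq0 q_neq0.
have {}tgT : q ^+ 2 * (Tx * (x2 - x1)) + p ^+ 2 * (Ty * (y2 - y1)) = 0.
  by rewrite -[RHS](mulr0 (p ^+ 2 * q ^+ 2)) -tgT; field; rewrite p_neq0 q_neq0.
(* The quadratic tangency condition of a line, free of the contact point: Lagrange's identity for (q
   T_x, p T_y) and (q d_x, p d_y), where d is the chord vector and T x d = P1 x P2. *)
have crossE : q ^+ 2 * (x2 - x1) ^+ 2 + p ^+ 2 * (y2 - y1) ^+ 2 =
    (x1 * y2 - y1 * x2) ^+ 2.
  have pq_neq0 : p ^+ 2 * q ^+ 2 != 0 by rewrite mulf_neq0 ?expf_neq0.
  apply: (mulfI pq_neq0).
  transitivity ((q ^+ 2 * (Tx * (x2 - x1)) + p ^+ 2 * (Ty * (y2 - y1))) ^+ 2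
     + p ^+ 2 * q ^+ 2 * (Tx * (y2 - y1) - Ty * (x2 - x1)) ^+ 2).
    by rewrite -{1}onT; ring.
  by rewrite tgT TxE TyE; ring.
(* Since p + q = 1, the quadratic condition factors into twice this number, which is |d|^2 / 2,
   times the bilinear one. *)
have e_neq0 : 1 - (x1 * x2 + y1 * y2) != 0.
  have d_gt0 : 0 < (x2 - x1) ^+ 2 + (y2 - y1) ^+ 2.
    by apply: sqrD_gt0; move: ne12; rewrite !xpair_eqE !subr_eq0 !(eq_sym x2) !(eq_sym y2).
  by apply: lt0r_neq0; nra.
apply: (mulfI e_neq0); apply: (mulfI (_ : (2 : F) != 0)); first by rewrite pnatr_eq0.
have y1E : y1 ^+ 2 = 1 - x1 ^+ 2 by rewrite -c1 addrAC subrr add0r.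
have y2E : y2 ^+ 2 = 1 - x2 ^+ 2 by rewrite -c2 addrAC subrr add0r.
rewrite !mulr0 -[RHS](subrr ((x1 * y2 - y1 * x2) ^+ 2)) -{2}crossE pqE.
ring: y1E y2E.
Qed.

(** The side opposite to [(x3, y3)] has equation q x3 X + p y3 Y + p q = 0, the tangent to the
    caustic at (-p x3, -q y3). This contact point lies on the side. *)
Lemma conj_chord_tangent x1 y1 x2 y2 x3 y3 :
  x3 ^+ 2 + y3 ^+ 2 = 1 -> (x1, y1) != (x2, y2) ->
  conj_chord x1 y1 x3 y3 -> conj_chord x2 y2 x3 y3 ->
  exists2 t, - (p * x3) = x1 + t * (x2 - x1) & - (q * y3) = y1 + t * (y2 - y1).
Proof.
move=> c3 ne12 m1 m2.
have d_neq0 : (x2 - x1, y2 - y1) != (0, 0).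
  by move: ne12; rewrite !xpair_eqE !subr_eq0 (eq_sym x2) (eq_sym y2).
have d_gt0 := sqrD_gt0 d_neq0; have dn0 := lt0r_neq0 d_gt0.
rewrite /conj_chord in m1 m2.
have n_neq0 : (q * x3, p * y3) != (0, 0).
  apply/eqP => -[/eqP]; rewrite mulf_eq0 (gt_eqF q_gt0) /=.
  move=> /eqP x30 /eqP; rewrite mulf_eq0 (gt_eqF p_gt0) /= => /eqP y30.
  by move/eqP: c3; rewrite x30 y30 expr0n addr0 eq_sym oner_eq0.
have y3E : y3 ^+ 2 = 1 - x3 ^+ 2 by rewrite -c3 addrAC subrr add0r.
have par : (- (p * x3) - x1) * (y2 - y1) - (- (q * y3) - y1) * (x2 - x1) = 0.
  apply: (cross_eq0 n_neq0); last by nra.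
  have pqc3 := congr1 (fun z => p * q * z) c3; rewrite /= in pqc3; nra.
set tx := - (p * x3); set ty := - (q * y3); rewrite -/tx -/ty in par.
(* The parameter of the orthogonal projection of the contact point; by [par] the point is its own
   projection. *)
exists (((tx - x1) * (x2 - x1) + (ty - y1) * (y2 - y1))
         / ((x2 - x1) ^+ 2 + (y2 - y1) ^+ 2)).
- apply: (mulfI dn0); transitivity (((x2 - x1) ^+ 2 + (y2 - y1) ^+ 2) * x1
  + ((tx - x1) * (x2 - x1) + (ty - y1) * (y2 - y1)) * (x2 - x1)); last by field.
  apply/eqP; rewrite -subr_eq0; apply/eqP.
  by rewrite -[RHS](mulr0 (y2 - y1)) -par; ring.
- apply: (mulfI dn0); transitivity (((x2 - x1) ^+ 2 + (y2 - y1) ^+ 2) * y1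
  + ((tx - x1) * (x2 - x1) + (ty - y1) * (y2 - y1)) * (y2 - y1)); last by field.
  apply/eqP; rewrite -subr_eq0; apply/eqP.
  by rewrite -[RHS](mulr0 (- (x2 - x1))) -par; ring.
Qed.

End UnitCircle.

(** * Existence of the triangles and range of the vertex sum *)

(** The line n.X = -p q with n = (q x, p y) meets the circle in -k n + h n' and -k n - h n', where
    n' is n turned by a quarter turn and k^2 + h^2 = 1 / |n|^2. These are the other two vertices. *)
Lemma conj_triangle_exists (F : rcfType) (p q x y : F) :
  0 < p -> 0 < q -> q = 1 - p -> x ^+ 2 + y ^+ 2 = 1 ->
  exists x2 y2 x3 y3 : F, conj_triangle p q x y x2 y2 x3 y3.
Proof.
move=> p_gt0 q_gt0 pqE c1.
have D_gt0 := polar_norm_gt0 p_gt0 q_gt0 c1.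
set D := polar_norm p q x y in D_gt0 *.
have D_neq0 := lt0r_neq0 D_gt0.
have yE : y ^+ 2 = 1 - x ^+ 2 by rewrite -c1 addrAC subrr add0r.
have DE : D = q ^+ 2 * x ^+ 2 + p ^+ 2 * (1 - x ^+ 2) by rewrite /D /polar_norm yE.
(* The line lies at distance less than 1 from the origin, so it is a secant. *)
have gap : 0 < D - (p * q) ^+ 2.
  have [p1 q1] : 0 < 1 - p ^+ 2 /\ 0 < 1 - q ^+ 2.
    by rewrite !subr_gt0 !expr_lt1 ?ltW //; split; lra.
  have -> : D - (p * q) ^+ 2 = (q * x) ^+ 2 * (1 - p ^+ 2) + (p * y) ^+ 2 * (1 - q ^+ 2).
    by rewrite DE !exprMn yE; ring.
  have XY_gt0 : 0 < (q * x) ^+ 2 + (p * y) ^+ 2 by rewrite !exprMn.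
  apply: lt_le_trans (mulr_gt0 (mulr_gt0 p1 q1) XY_gt0) _.
  rewrite mulrDr lerD // mulrC ler_wpM2l ?sqr_ge0 //.
  - by rewrite (ler_piMr (ltW p1)) // gerBl sqr_ge0.
  - by rewrite (ler_piMl (ltW q1)) // gerBl sqr_ge0.
have [h h_gt0 h2] : exists2 h, 0 < h & h ^+ 2 = (D - (p * q) ^+ 2) / D ^+ 2.
  exists (Num.sqrt (D - (p * q) ^+ 2) / D); first by rewrite divr_gt0 ?sqrtr_gt0.
  by rewrite expr_div_n sqr_sqrtr ?ltW.
pose k := p * q / D.
exists (- k * (q * x) - h * (p * y)), (- k * (p * y) + h * (q * x)),
       (- k * (q * x) + h * (p * y)), (- k * (p * y) - h * (q * x)).
have on e : e ^+ 2 = 1 -> (- k * (q * x) - e * h * (p * y)) ^+ 2 +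
    (- k * (p * y) + e * h * (q * x)) ^+ 2 = 1.
  move=> e2; transitivity ((k ^+ 2 + e ^+ 2 * h ^+ 2) * D).
    by rewrite /D /polar_norm; ring.
  by rewrite e2 h2 /k; field.
have chord e : conj_chord p q x y (- k * (q * x) - e * h * (p * y))
                                  (- k * (p * y) + e * h * (q * x)).
  rewrite /conj_chord; transitivity (- k * D + p * q).
    by rewrite /D /polar_norm; ring.
  by rewrite /k; field.
split.
- split=> //.
  + by have := on 1; rewrite mul1r; apply; rewrite expr1n.
  + by have := on (-1); rewrite mulN1r !mulNr opprK; apply; rewrite sqrrN expr1n.
- apply/eqP => -[ex ey].
  have /eqP : h * (p * y) = 0 by lra.
  have /eqP : h * (q * x) = 0 by lra.
  rewrite !mulf_eq0 (gt_eqF h_gt0) (gt_eqF p_gt0) (gt_eqF q_gt0) /=.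
  move=> /eqP x0 /eqP y0; move/eqP: c1.
  by rewrite x0 y0 expr0n addr0 eq_sym oner_eq0.
- split.
  + by have := chord 1; rewrite mul1r.
  (* Poncelet closure: the third side is tangent as well, an identity in p and x once D and q are
     eliminated. *)
  + rewrite /conj_chord.
    transitivity (q * (k ^+ 2 * (q ^+ 2 * x ^+ 2) - h ^+ 2 * (p ^+ 2 * y ^+ 2))
     + p * (k ^+ 2 * (p ^+ 2 * y ^+ 2) - h ^+ 2 * (q ^+ 2 * x ^+ 2)) + p * q).
      by ring.
    apply: (mulfI (expf_neq0 2 D_neq0)); rewrite h2 /k yE mulr0.
    transitivity (q * ((p * q) ^+ 2 * (q ^+ 2 * x ^+ 2)
         - (D - (p * q) ^+ 2) * (p ^+ 2 * (1 - x ^+ 2)))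
       + p * ((p * q) ^+ 2 * (p ^+ 2 * (1 - x ^+ 2))
         - (D - (p * q) ^+ 2) * (q ^+ 2 * x ^+ 2)) + p * q * D ^+ 2).
      by field.
    by rewrite DE pqE; ring.
  + apply: conj_chordC; have := chord (-1); by rewrite mulN1r !mulNr opprK.
Qed.

(** By [conj_triangle_sum] with y^2 = 1 - x^2, the bracket is D (S_x - w (q - p)). The factor
    [q - p], of unknown sign, turns the values at -1 and 1 into a square times -(1 + w) and 1 -
    w. *)
Lemma conj_triangle_sum_root (F : rcfType) (p q w : F) :
  0 < p -> 0 < q -> q = 1 - p -> -1 <= w <= 1 ->
  exists2 x, -1 <= x <= 1 &
    (q - p) * (x * (q ^+ 2 * x ^+ 2 + p ^+ 2 * (1 - x ^+ 2) - 2 * p * q ^+ 2)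
      - w * (q - p) * (q ^+ 2 * x ^+ 2 + p ^+ 2 * (1 - x ^+ 2))) = 0.
Proof.
move=> p_gt0 q_gt0 pqE /andP[w_geN1 w_le1].
pose D : {poly F} := (q ^+ 2) *: 'X^2 + (p ^+ 2) *: (1 - 'X^2).
pose P : {poly F} :=
  (q - p) *: ('X * (D - (2 * p * q ^+ 2)%:P) - (w * (q - p)) *: D).
have PE x : P.[x] =
    (q - p) * (x * (q ^+ 2 * x ^+ 2 + p ^+ 2 * (1 - x ^+ 2) - 2 * p * q ^+ 2)
      - w * (q - p) * (q ^+ 2 * x ^+ 2 + p ^+ 2 * (1 - x ^+ 2))).
  by rewrite /P /D !hornerE.
have [||x x_in /rootP] := @poly_ivt F P (-1) 1.
- by lra.
- rewrite !PE !expr1n !sqrrN !expr1n.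
  apply/andP; split.
  + have -> : (q - p) *
      (-1 * (q ^+ 2 * 1 + p ^+ 2 * (1 - 1) - 2 * p * q ^+ 2) -
       w * (q - p) * (q ^+ 2 * 1 + p ^+ 2 * (1 - 1))) =
      - ((1 + w) * (q * (q - p)) ^+ 2) by rewrite pqE; ring.
    by rewrite oppr_le0 mulr_ge0 ?sqr_ge0 //; lra.
  + have -> : (q - p) *
      (1 * (q ^+ 2 * 1 + p ^+ 2 * (1 - 1) - 2 * p * q ^+ 2) -
       w * (q - p) * (q ^+ 2 * 1 + p ^+ 2 * (1 - 1))) =
      (1 - w) * (q * (q - p)) ^+ 2 by rewrite pqE; ring.
    by rewrite mulr_ge0 ?sqr_ge0 //; lra.
by rewrite PE => Px0; exists x.
Qed.

Lemma conj_triangle_sum_surj (F : rcfType) (p q w : F) :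
  0 < p -> 0 < q -> q = 1 - p -> q - p != 0 -> -1 <= w <= 1 ->
  exists x1 y1 x2 y2 x3 y3,
    conj_triangle p q x1 y1 x2 y2 x3 y3 /\ x1 + x2 + x3 = w * (q - p).
Proof.
move=> p_gt0 q_gt0 pqE qp_neq0 w_in.
have [x x_in root_x] := conj_triangle_sum_root p_gt0 q_gt0 pqE w_in.
have x2_le1 : 0 <= 1 - x ^+ 2 by move: x_in => /andP[? ?]; nra.
have c1 : x ^+ 2 + Num.sqrt (1 - x ^+ 2) ^+ 2 = 1 by rewrite sqr_sqrtr // addrC subrK.
have [x2 [y2 [x3 [y3 tri]]]] := conj_triangle_exists p_gt0 q_gt0 pqE c1.
exists x, (Num.sqrt (1 - x ^+ 2)), x2, y2, x3, y3; split=> //.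
have [sx _] := conj_triangle_sum tri.
have D_gt0 := polar_norm_gt0 p_gt0 q_gt0 c1.
apply: (mulfI (lt0r_neq0 D_gt0)); rewrite sx.
move: root_x => /eqP; rewrite mulf_eq0 (negPf qp_neq0) subr_eq0 => /eqP.
by rewrite /polar_norm sqr_sqrtr // => ->; rewrite mulrC.
Qed.

(** Reflection in the diagonal; it carries the range of S_x over to S_y. *)
Lemma conj_triangle_swap (F : realFieldType) (p q x1 y1 x2 y2 x3 y3 : F) :
  conj_triangle p q x1 y1 x2 y2 x3 y3 -> conj_triangle q p y1 x1 y2 x2 y3 x3.
Proof.
case=> -[c1 c2 c3] ne [m1 m2 m3]; split.
- by split; rewrite addrC.
- by move: ne; rewrite !xpair_eqE andbC.
- by move: m1 m2 m3; rewrite /conj_chord (mulrC q p) => m1 m2 m3; split; lra.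
Qed.

(** * From the unit circle back to the confocal pair *)

Section ConfocalPair.
Variables (R : realType) (a b p q : R).
Hypotheses (a_gt0 : 0 < a) (b_gt0 : 0 < b) (p_gt0 : 0 < p) (q_gt0 : 0 < q).
Hypotheses (pqE : q = 1 - p) (qp_neq0 : q - p != 0).
Hypotheses (caE : caustic_a a b = a * p) (cbE : caustic_b a b = b * q).

Let a_neq0 : a != 0. Proof. exact: lt0r_neq0. Qed.
Let b_neq0 : b != 0. Proof. exact: lt0r_neq0. Qed.
Let p_neq0 : p != 0. Proof. exact: lt0r_neq0. Qed.
Let q_neq0 : q != 0. Proof. exact: lt0r_neq0. Qed.

Lemma dotE (u v : 'rV[R]_2) : dot u v = u 0 0 * v 0 0 + u 0 1 * v 0 1.
Proof.
rewrite /dot big_ord_recl big_ord1; congr (_ + _ * _); congr (_ _ _);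
exact: val_inj.
Qed.

Lemma row2P (u v : 'rV[R]_2) : u 0 0 = v 0 0 -> u 0 1 = v 0 1 -> u = v.
Proof.
move=> uv0 uv1; apply/rowP => -[[|[|//]] i_lt2].
- by rewrite (_ : Ordinal i_lt2 = 0) //; apply: val_inj.
- by rewrite (_ : Ordinal i_lt2 = 1) //; apply: val_inj.
Qed.

Definition point (x y : R) : 'rV[R]_2 := \row_i (if i == 0 then x else y).

Lemma point0 x y : point x y 0 0 = x. Proof. by rewrite mxE. Qed.
Lemma point1 x y : point x y 0 1 = y. Proof. by rewrite mxE. Qed.

Lemma point_inj x y x' y' :
  point (a * x) (b * y) = point (a * x') (b * y') -> (x, y) = (x', y').
Proof.
move=> e; have := congr1 (fun P : 'rV_2 => P 0 0) e.
have := congr1 (fun P : 'rV_2 => P 0 1) e; rewrite !point0 !point1.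
by move=> /(mulfI b_neq0) -> /(mulfI a_neq0) ->.
Qed.

Lemma ellipse_pointP P :
  std_ellipse a b P -> exists x y, x ^+ 2 + y ^+ 2 = 1 /\ P = point (a * x) (b * y).
Proof.
rewrite /std_ellipse /= => onP; exists (P 0 0 / a), (P 0 1 / b); split.
  by rewrite !expr_div_n.
by apply: row2P; rewrite ?point0 ?point1 mulrC divfK.
Qed.

Lemma ellipse_point x y :
  x ^+ 2 + y ^+ 2 = 1 -> std_ellipse a b (point (a * x) (b * y)).
Proof.
move=> c; rewrite /std_ellipse /= point0 point1 -c.
by field; rewrite a_neq0 b_neq0.
Qed.

(** Dividing coordinates by a and b maps the caustic to the ellipse of semi-axes [p], [q] and
    preserves contact, at the same parameter [t]. *)
Lemma tangent_chord x1 y1 x2 y2 :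
  x1 ^+ 2 + y1 ^+ 2 = 1 -> x2 ^+ 2 + y2 ^+ 2 = 1 -> (x1, y1) != (x2, y2) ->
  side_tangent (caustic_a a b) (caustic_b a b)
    (point (a * x1) (b * y1)) (point (a * x2) (b * y2)) ->
  conj_chord p q x1 y1 x2 y2.
Proof.
move=> c1 c2 ne12 [T [onT [t _ TE]]].
rewrite dotE /std_ellipse_grad /std_ellipse /= in onT *.
rewrite -TE caE cbE !mxE /= in onT *.
move=> tgT; apply: (tangent_conj_chord (t := t) p_gt0 q_gt0 pqE c1 c2 ne12 erefl erefl).
- by rewrite -[RHS]onT; field; rewrite a_neq0 b_neq0 p_neq0 q_neq0.
- apply: (mulfI (_ : (2 : R) != 0)); first by rewrite pnatr_eq0.
  rewrite mulr0 -[RHS]tgT; field.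
  by rewrite a_neq0 b_neq0 p_neq0 q_neq0.
Qed.

Lemma chord_tangent x1 y1 x2 y2 x3 y3 :
  x3 ^+ 2 + y3 ^+ 2 = 1 -> (x1, y1) != (x2, y2) ->
  conj_chord p q x1 y1 x3 y3 -> conj_chord p q x2 y2 x3 y3 ->
  side_tangent (caustic_a a b) (caustic_b a b)
    (point (a * x1) (b * y1)) (point (a * x2) (b * y2)).
Proof.
move=> c3 ne12 m1 m2.
have [t tx ty] := conj_chord_tangent p_gt0 q_gt0 c3 ne12 m1 m2.
exists (point (a * - (p * x3)) (b * - (q * y3))); split.
- rewrite /std_ellipse /= caE cbE point0 point1 -c3.
  by field; rewrite a_neq0 b_neq0 p_neq0 q_neq0.
- exists t => //; apply: row2P; rewrite !mxE /= ?tx ?ty; ring.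
- rewrite dotE /std_ellipse_grad !mxE /= caE cbE.
  transitivity (- (2 / (p * q)) *
    ((q * (x2 * x3) + p * (y2 * y3) + p * q)
     - (q * (x1 * x3) + p * (y1 * y3) + p * q))).
    by field; rewrite a_neq0 b_neq0 p_neq0 q_neq0.
  by rewrite m1 m2 subrr mulr0.
Qed.

Lemma poncelet_triangle_conj A B C :
  poncelet_triangle a b A B C -> exists x1 y1 x2 y2 x3 y3,
  [/\ A = point (a * x1) (b * y1), B = point (a * x2) (b * y2),
      C = point (a * x3) (b * y3) & conj_triangle p q x1 y1 x2 y2 x3 y3].
Proof.
case=> -[AB ABC] [/ellipse_pointP[x1 [y1 [c1 AE]]]
  /ellipse_pointP[x2 [y2 [c2 BE]]] /ellipse_pointP[x3 [y3 [c3 CE]]]] [tAB tBC tCA].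
exists x1, y1, x2, y2, x3, y3; split=> //.
have ne12 : (x1, y1) != (x2, y2).
  by apply/eqP => -[ex ey]; apply: AB; rewrite AE BE ex ey.
have ne23 : (x2, y2) != (x3, y3).
  (* Non-collinearity excludes C = B and C = A, the points of line AB at parameters 1 and 0. *)
  apply/eqP => -[ex ey]; apply: ABC; exists 1 => //.
  by rewrite scale1r addrC subrK BE CE ex ey.
have ne31 : (x3, y3) != (x1, y1).
  apply/eqP => -[ex ey]; apply: ABC; exists 0 => //.
  by rewrite scale0r addr0 AE CE ex ey.
rewrite AE BE CE in tAB tBC tCA.
by split=> //; split; apply: tangent_chord.
Qed.

Lemma conj_poncelet_triangle x1 y1 x2 y2 x3 y3 :
  conj_triangle p q x1 y1 x2 y2 x3 y3 ->
  poncelet_triangle a b (point (a * x1) (b * y1)) (point (a * x2) (b * y2))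
    (point (a * x3) (b * y3)).
Proof.
move=> tri; have cross := conj_triangle_cross p_gt0 q_gt0 tri.
have rot := conj_triangle_rot p_gt0 q_gt0 tri.
have rot2 := conj_triangle_rot p_gt0 q_gt0 rot.
case: (tri) => -[c1 c2 c3] ne23 [m12 m23 m31].
case: rot => _ ne31 _; case: rot2 => _ ne12 _.
split.
- split; first by move=> /point_inj/eqP; rewrite (negPf ne12).
  case=> t _ E; move/eqP: cross; apply.
  have := congr1 (fun P : 'rV_2 => P 0 0) E.
  have := congr1 (fun P : 'rV_2 => P 0 1) E; rewrite !mxE /= => Ey Ex.
  have -> : x3 = x1 + t * (x2 - x1) by apply: (mulfI a_neq0); rewrite -Ex; ring.
  have -> : y3 = y1 + t * (y2 - y1) by apply: (mulfI b_neq0); rewrite -Ey; ring.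
  by ring.
- by split; apply: ellipse_point.
- split.
  + by apply: chord_tangent c3 _ _ _ => //; apply: conj_chordC.
  + by apply: chord_tangent c1 _ _ _ => //; apply: conj_chordC.
  + by apply: chord_tangent c2 _ _ _ => //; apply: conj_chordC.
Qed.

Let k := a ^+ 2 - b ^+ 2.

(** On the circle a^2 x^2 + b^2 y^2 = k x^2 + b^2, so the quadratic terms leave only [k], the c^2 of
    the pair. *)
Lemma equidistantE x1 y1 x2 y2 ox oy :
  x1 ^+ 2 + y1 ^+ 2 = 1 -> x2 ^+ 2 + y2 ^+ 2 = 1 ->
  let d x y := dot (point (a * x) (b * y) - point ox oy)
                   (point (a * x) (b * y) - point ox oy) in
  d x1 y1 - d x2 y2 =
  k * (x1 ^+ 2 - x2 ^+ 2) - (2 * a * ox * (x1 - x2) + 2 * b * oy * (y1 - y2)).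
Proof.
move=> c1 c2 /=; rewrite !dotE !mxE /= /k.
have y1E : y1 ^+ 2 = 1 - x1 ^+ 2 by rewrite -c1 addrAC subrr add0r.
have y2E : y2 ^+ 2 = 1 - x2 ^+ 2 by rewrite -c2 addrAC subrr add0r.
ring: y1E y2E.
Qed.

Lemma circumcenterP x1 y1 x2 y2 x3 y3 ox oy :
  conj_triangle p q x1 y1 x2 y2 x3 y3 ->
  is_circumcenter (point (a * x1) (b * y1)) (point (a * x2) (b * y2))
    (point (a * x3) (b * y3)) (point ox oy) <->
  ox = k * q * (x1 + x2 + x3) / (2 * a * (q - p)) /\
  oy = k * p * (y1 + y2 + y3) / (2 * b * (q - p)).
Proof.
move=> tri; have cross := conj_triangle_cross p_gt0 q_gt0 tri.
have rot := conj_triangle_rot p_gt0 q_gt0 tri.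
have rot2 := conj_triangle_rot p_gt0 q_gt0 rot.
have h23 := conj_triangle_circumcenter p_gt0 q_gt0 tri.
have h31 := conj_triangle_circumcenter p_gt0 q_gt0 rot.
have h12 := conj_triangle_circumcenter p_gt0 q_gt0 rot2.
case: (tri) => -[c1 c2 c3] _ _.
have e12 := @equidistantE x1 y1 x2 y2 ox oy c1 c2.
have e13 := @equidistantE x1 y1 x3 y3 ox oy c1 c3.
have e23 := @equidistantE x2 y2 x3 y3 ox oy c2 c3.
rewrite /is_circumcenter; split.
- case=> d12 d13; move/eqP: (d12); rewrite -subr_eq0 e12 => /eqP {}e12.
  have {}e23 : k * (x2 ^+ 2 - x3 ^+ 2) -
      (2 * a * ox * (x2 - x3) + 2 * b * oy * (y2 - y3)) = 0.
    by rewrite -e23 -d12 -d13 subrr.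
  (* The deviation from the claimed center, scaled, is orthogonal to the independent sides B - C and
     A - B. *)
  have [] := @orthogonal_eq0 _ _ _ _ _
     (2 * a * (q - p) * ox - k * q * (x1 + x2 + x3))
     (2 * b * (q - p) * oy - k * p * (y1 + y2 + y3)) cross.
  + rewrite -[RHS](mulr0 (- (q - p))) -e23.
    transitivity ((q - p) * (2 * a * ox * (x2 - x3) + 2 * b * oy * (y2 - y3))
      - k * (q * (x1 + x2 + x3) * (x2 - x3) + p * (y1 + y2 + y3) * (y2 - y3))).
      by ring.
    by rewrite h23; ring.
  + rewrite -[RHS](mulr0 (- (q - p))) -e12.
    transitivity ((q - p) * (2 * a * ox * (x1 - x2) + 2 * b * oy * (y1 - y2))
      - k * (q * (x3 + x1 + x2) * (x1 - x2) + p * (y3 + y1 + y2) * (y1 - y2))).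
      by ring.
    by rewrite h12; ring.
  + move=> /subr0_eq <- /subr0_eq <-; split; field; by rewrite ?a_neq0 ?b_neq0 qp_neq0.
- case=> oxE oyE; split; apply/eqP; rewrite -subr_eq0.
  + rewrite e12; apply/eqP; apply: (mulfI qp_neq0).
    rewrite mulrBr mulrCA -h12 oxE oyE; field.
    by rewrite ?a_neq0 ?b_neq0 qp_neq0.
  + rewrite e13; apply/eqP; apply: (mulfI qp_neq0).
    transitivity (- (k * ((q - p) * (x3 ^+ 2 - x1 ^+ 2)))
      - (q - p) * (2 * a * ox * (x1 - x3) + 2 * b * oy * (y1 - y3))).
      by ring.
    rewrite -h31 oxE oyE; field.
    by rewrite ?a_neq0 ?b_neq0 qp_neq0.
Qed.

(** The factors of the vertex sums are m_x and m_y. *)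
Lemma locusP alpha beta X :
  locus a b alpha beta X <-> exists x1 y1 x2 y2 x3 y3,
  conj_triangle p q x1 y1 x2 y2 x3 y3 /\
  X = point ((alpha * (a / 3) + beta * (k * q / (2 * a * (q - p)))) * (x1 + x2 + x3))
            ((alpha * (b / 3) + beta * (k * p / (2 * b * (q - p)))) * (y1 + y2 + y3)).
Proof.
split.
- case=> A [B [C [O [/poncelet_triangle_conj[x1 [y1 [x2 [y2 [x3 [y3 [-> -> -> tri]]]]]]]]]]].
  have -> : O = point (O 0 0) (O 0 1) by apply: row2P; rewrite ?point0 ?point1.
  move=> /(circumcenterP _ _ tri)[-> ->] ->.
  exists x1, y1, x2, y2, x3, y3; split=> //.
  by apply: row2P; rewrite !mxE /=; field; rewrite ?a_neq0 ?b_neq0 qp_neq0.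
- case=> x1 [y1 [x2 [y2 [x3 [y3 [tri ->]]]]]].
  exists (point (a * x1) (b * y1)), (point (a * x2) (b * y2)), (point (a * x3) (b * y3)).
  exists (point (k * q * (x1 + x2 + x3) / (2 * a * (q - p)))
                (k * p * (y1 + y2 + y3) / (2 * b * (q - p)))).
  split; [exact: conj_poncelet_triangle | exact/(circumcenterP _ _ tri) |].
  by apply: row2P; rewrite !mxE /=; field; rewrite ?a_neq0 ?b_neq0 qp_neq0.
Qed.

End ConfocalPair.

(** * Degenerate loci and the two ratios *)

Lemma degenerate_segment (R : realType) (m : R) (e f : 'rV[R]_2) (E : set 'rV[R]_2) :
  dot e e = 1 -> dot f f = 1 -> dot f e = 0 ->
  (forall X, E X <-> exists2 w, -1 <= w <= 1 & X = (m * w) *: e) ->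
  degenerate E.
Proof.
move=> ee ff fe EP; exists 0, `|m|; split; last by left.
(* Semi-axes are nonnegative, so the sign of [m] goes into the axis direction; [w] is the sine of
   the ellipse parameter. *)
exists 0, f, ((-1) ^+ (m < 0)%R *: e); split; rewrite ?lexx ?normr_ge0 //.
  split=> //.
  - by rewrite dotE !mxE mulrACA [X in _ + X]mulrACA -expr2 sqrr_sign !mul1r -dotE.
  - by rewrite dotE !mxE mulrCA [X in _ + X]mulrCA -mulrDr -dotE fe mulr0.
rewrite eqEsubset; split=> X.
- case/EP => w w_in ->; exists (asin w) => //.
  rewrite mul0r scale0r !add0r scalerA mulrAC [`|m| * _]mulrC -numEsign.
  by rewrite asinK.
- case=> t _ <-; apply/EP; exists (sin t); first by rewrite sin_geN1 sin_le1.
  by rewrite mul0r scale0r !add0r scalerA mulrAC [`|m| * _]mulrC -numEsign.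
Qed.

Theorem proposition3 (R : realType) (a b alpha beta : R)
    (b_gt0 : 0 < b) (b_lt_a : b < a) (beta_neq0 : beta <> 0)
    (ratio :
      alpha / beta = (2%:R * a ^+ 2 - b ^+ 2 + delta a b) / (2%:R * b ^+ 2) \/
      alpha / beta = (2%:R * b ^+ 2 - a ^+ 2 + delta a b) / (2%:R * a ^+ 2)) :
  degenerate (locus a b alpha beta).
Proof.
have a_gt0 := lt_trans b_gt0 b_lt_a.
have [a_neq0 b_neq0] := (lt0r_neq0 a_gt0, lt0r_neq0 b_gt0).
have k_gt0 : 0 < a ^+ 2 - b ^+ 2 by nra.
have k_neq0 := lt0r_neq0 k_gt0.
have ab_gt0 : 0 < a ^+ 2 * b ^+ 2 by rewrite mulr_gt0 ?exprn_gt0.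
set d := delta a b in ratio.
have d_ge0 : 0 <= d by rewrite sqrtr_ge0.
have d2 : d ^+ 2 = a ^+ 4 - a ^+ 2 * b ^+ 2 + b ^+ 4.
  rewrite sqr_sqrtr //.
  have -> : a ^+ 4 - a ^+ 2 * b ^+ 2 + b ^+ 4 =
    (a ^+ 2 - b ^+ 2) ^+ 2 + a ^+ 2 * b ^+ 2 by ring.
  by rewrite addr_ge0 ?sqr_ge0 // ltW.
have b2_lt_d : b ^+ 2 < d.
  rewrite -(ltr_pXn2r (n := 2)) ?nnegrE ?sqr_ge0 // -subr_gt0 d2.
  have -> : a ^+ 4 - a ^+ 2 * b ^+ 2 + b ^+ 4 - b ^+ 2 ^+ 2 =
    a ^+ 2 * (a ^+ 2 - b ^+ 2) by ring.
  by rewrite mulr_gt0 ?exprn_gt0.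
have d_lt_a2 : d < a ^+ 2.
  rewrite -(ltr_pXn2r (n := 2)) ?nnegrE ?sqr_ge0 // -subr_gt0 d2.
  have -> : a ^+ 2 ^+ 2 - (a ^+ 4 - a ^+ 2 * b ^+ 2 + b ^+ 4) =
    b ^+ 2 * (a ^+ 2 - b ^+ 2) by ring.
  by rewrite mulr_gt0 ?exprn_gt0.
(* This is c^2 (q - p); its product with the conjugate in d is -3 c^4. *)
have s_neq0 : a ^+ 2 + b ^+ 2 - 2 * d != 0.
  have : (a ^+ 2 + b ^+ 2 - 2 * d) * (a ^+ 2 + b ^+ 2 + 2 * d) != 0.
    have -> : (a ^+ 2 + b ^+ 2 - 2 * d) * (a ^+ 2 + b ^+ 2 + 2 * d) =
      - (3 * (a ^+ 2 - b ^+ 2) ^+ 2) by ring: d2.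
    by rewrite oppr_eq0 mulf_neq0 ?expf_neq0 ?pnatr_eq0.
  by rewrite mulf_eq0 negb_or => /andP[].
pose p := (d - b ^+ 2) / (a ^+ 2 - b ^+ 2).
pose q := (a ^+ 2 - d) / (a ^+ 2 - b ^+ 2).
have p_gt0 : 0 < p by rewrite divr_gt0 // subr_gt0.
have q_gt0 : 0 < q by rewrite divr_gt0 // subr_gt0.
have pqE : q = 1 - p by rewrite /p /q; field.
have qpE : q - p = (a ^+ 2 + b ^+ 2 - 2 * d) / (a ^+ 2 - b ^+ 2).
  by rewrite /p /q; field.
have qp_neq0 : q - p != 0 by rewrite qpE mulf_neq0 ?invr_eq0.
have caE : caustic_a a b = a * p by rewrite /caustic_a /p mulrA.
have cbE : caustic_b a b = b * q by rewrite /caustic_b /q mulrA.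
have lP := locusP a_gt0 b_gt0 p_gt0 q_gt0 pqE qp_neq0 caE cbE alpha beta.
have e0 : dot (point 1 0) (point 1 0) = 1 :> R.
  by rewrite dotE !point0 !point1 mulr0 addr0 mulr1.
have e1 : dot (point 0 1) (point 0 1) = 1 :> R.
  by rewrite dotE !point0 !point1 mulr0 add0r mulr1.
have e01 : dot (point 0 1) (point 1 0) = 0 :> R.
  by rewrite dotE !point0 !point1 mulr0 mul0r addr0.
have e10 : dot (point 1 0) (point 0 1) = 0 :> R.
  by rewrite dotE !point0 !point1 mulr0 mul0r addr0.
have in_unit x y : x ^+ 2 + y ^+ 2 = (q - p) ^+ 2 -> -1 <= x / (q - p) <= 1.
  move=> xy; rewrite -ler_norml normrM normfV ler_pdivrMr ?normr_gt0 // mul1r.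
  rewrite -(ler_pXn2r (n := 2)) ?nnegrE ?normr_ge0 //.
  by rewrite !real_normK ?num_real // -xy lerDl sqr_ge0.
move/eqP: beta_neq0 => bF.
set mx := alpha * (a / 3) + _ in lP; set my := alpha * (b / 3) + _ in lP.
have aE r : alpha / beta = r -> alpha = r * beta.
  by move=> <-; rewrite divfK.
case: ratio => /aE alphaE.
(* The first ratio makes the bracket vanish modulo the equation [d2] for d^2. *)
- have my0 : my = 0.
    transitivity (beta / (6 * b * (a ^+ 2 + b ^+ 2 - 2 * d)) *
      ((2 * a ^+ 2 - b ^+ 2 + d) * (a ^+ 2 + b ^+ 2 - 2 * d)
       + 3 * (a ^+ 2 - b ^+ 2) * (d - b ^+ 2))).
      by rewrite /my alphaE qpE /p; field; rewrite b_neq0 k_neq0 s_neq0.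
    by ring: d2.
  apply: (degenerate_segment (m := mx * (q - p)) e0 e1 e01) => X; split.
  + move=> /lP[x1 [y1 [x2 [y2 [x3 [y3 [tri ->]]]]]]].
    exists ((x1 + x2 + x3) / (q - p)).
      exact/in_unit/(conj_triangle_sum_norm p_gt0 q_gt0 pqE tri).
    by apply: row2P; rewrite !mxE /= ?my0; field.
  + case=> w w_in ->; apply/lP.
    have [x1 [y1 [x2 [y2 [x3 [y3 [tri sE]]]]]]] :=
      conj_triangle_sum_surj p_gt0 q_gt0 pqE qp_neq0 w_in.
    exists x1, y1, x2, y2, x3, y3; split=> //.
    by apply: row2P; rewrite !mxE /= ?my0 ?sE; ring.
- have mx0 : mx = 0.
    transitivity (beta / (6 * a * (a ^+ 2 + b ^+ 2 - 2 * d)) *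
      ((2 * b ^+ 2 - a ^+ 2 + d) * (a ^+ 2 + b ^+ 2 - 2 * d)
       + 3 * (a ^+ 2 - b ^+ 2) * (a ^+ 2 - d))).
      by rewrite /mx alphaE qpE /q; field; rewrite a_neq0 k_neq0 s_neq0.
    by ring: d2.
  apply: (degenerate_segment (m := my * (q - p)) e1 e0 e10) => X; split.
  + move=> /lP[x1 [y1 [x2 [y2 [x3 [y3 [tri ->]]]]]]].
    exists ((y1 + y2 + y3) / (q - p)).
      apply/in_unit; rewrite addrC.
      exact: (conj_triangle_sum_norm p_gt0 q_gt0 pqE tri).
    by apply: row2P; rewrite !mxE /= ?mx0; field.
  + case=> w w_in ->; apply/lP.
    have pqE' : p = 1 - q by rewrite pqE; ring.
    have pq_neq0 : p - q != 0 by rewrite -opprB oppr_eq0.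
    (* Exchanging p and q turns the target w (q - p) for S_y into (-w) (p - q). *)
    have w_in' : -1 <= - w <= 1 by move: w_in => /andP[? ?]; apply/andP; split; lra.
    have [y1 [x1 [y2 [x2 [y3 [x3 [/conj_triangle_swap tri sE]]]]]]] :=
      conj_triangle_sum_surj q_gt0 p_gt0 pqE' pq_neq0 w_in'.
    exists x1, y1, x2, y2, x3, y3; split=> //.
    by apply: row2P; rewrite !mxE /= ?mx0 ?sE; ring.
Qed.
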